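(* For each integer $d\ge 1$, define on $[1,\infty)$ the function $$g_d(x)=\begin{cases}\dfrac{2U_{\frac d2-1}(x)}{V_{\frac d2}(x)} & \text{if } d \text{ is even},\\[2ex] \dfrac{W_{\frac{d-1}{2}}(x)}{T_{\frac{d+1}{2}}(x)} & \text{if } d\text{ is odd}.\end{cases}$$ Then for all $x\in[1,\infty)$, $$g_d(x)=\sum_{i=0}^{\infty}\frac{\Delta^S_{i,d-1}}{2^{i}x^{i+1}}.$$
   Context: $T_k,U_k,V_k,W_k$ denote the Chebyshev polynomials of the first, second, third and fourth kind. All four families satisfy $P_{k+2}(X)=2XP_{k+1}(X)-P_k(X)$ for $k\ge 0$, with initial values $T_0=1,\ T_1=X$; $U_0=1,\ U_1=2X$; $V_0=1,\ V_1=2X-1$; $W_0=1,\ W_1=2X+1$. For $n,h\ge 0$, $\Delta^S_{n,h}$ denotes the number of symmetric Dyck paths of semilength $n$ and of maximum height $h$, i.e. lattice walks from $(0,0)$ to $(2n,0)$ with steps $(1,1)$ and $(1,-1)$ whose height always stays in $[0,h]$ (the bound $h$ need not be attained) and which are symmetric with respect to the vertical line of abscissa $n$. In particular $\Delta^S_{0,h}=1$ for all $h\ge0$ and $\Delta^S_{n,0}=0$ for $n\ge 1$. *)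

(* Defs.v *)
From HB Require Import structures.
From mathcomp Require Import all_boot all_order all_algebra.
From mathcomp Require Import all_classical all_reals all_analysis.
Set Implicit Arguments.
Unset Strict Implicit.
Unset Printing Implicit Defensive.
Import Order.TTheory GRing.Theory Num.Theory.
Import numFieldNormedType.Exports.
Local Open Scope ring_scope.

Fixpoint chebyshev (R : nzRingType) (P0 P1 : {poly R}) (k : nat) : {poly R} :=
  match k with
  | 0 => P0
  | 1 => P1
  | (k''.+1 as k').+1 =>
      2%:R * 'X * chebyshev P0 P1 k' - chebyshev P0 P1 k''
  end.

Definition chebT (R : nzRingType) := @chebyshev R 1 'X.
Definition chebU (R : nzRingType) := @chebyshev R 1 (2%:R * 'X).
Definition chebV (R : nzRingType) := @chebyshev R 1 (2%:R * 'X - 1).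
Definition chebW (R : nzRingType) := @chebyshev R 1 (2%:R * 'X + 1).

(* A walk from (0,0) is encoded by its steps: true is (1,1), false is (1,-1);
   height w k is its ordinate at abscissa k, for k <= size w. *)
Definition height (w : seq bool) (k : nat) : int :=
  \sum_(s <- take k w) (if s then 1 else -1).

Definition dyck_path (n h : nat) (w : (2 * n).-tuple bool) : bool :=
  (height w (2 * n) == 0)
  && [forall k : 'I_(2 * n).+1, 0 <= height w k <= h%:Z].

Definition symmetric_path (n : nat) (w : (2 * n).-tuple bool) : bool :=
  [forall k : 'I_(2 * n).+1, height w (2 * n - k) == height w k].

Definition DeltaS (n h : nat) : nat :=
  #|[set w : (2 * n).-tuple bool | dyck_path h w && symmetric_path w]|.

(* Division is total with y / 0 = 0.  On [1, +oo[ both denominators are in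
   fact positive, and the expansion of g d x as a series of nonnegative terms
   with first term x^-1 > 0 would fail at any zero of a denominator. *)
Definition g (R : realType) (d : nat) (x : R) : R :=
  if odd d then (chebW R d.-1./2).[x] / (chebT R d.+1./2).[x]
  else 2 * (chebU R d./2.-1).[x] / (chebV R d./2).[x].

(* Main.v *)
Require Import Defs.
From HB Require Import structures.
From mathcomp Require Import all_boot all_order all_algebra.
From mathcomp Require Import all_classical all_reals all_analysis.
From mathcomp Require Import zify ring lra.
Set Implicit Arguments.
Unset Strict Implicit.
Unset Printing Implicit Defensive.
Import Order.TTheory GRing.Theory Num.Theory.
Import numFieldNormedType.Exports.
Local Open Scope classical_set_scope.
Local Open Scope ring_scope.

(** A symmetric Dyck path of semilength [n] is determined by its first half, an
    arbitrary walk of [n] steps from height 0 inside [[0, h]]. Shifting heights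
    by one and writing [d = h + 1], these are the [n]-step walks from vertex 1
    on the path graph with vertices [1, ..., d]; 0 and [d + 1] act as absorbing
    walls ([DeltaS_confined], [card_confined]).

    Let [E k] be the sum over [n] of (number of [n]-step walks from [k]) divided
    by [2 ^ n * x ^ (n + 1)]. Conditioning on the first step gives
      [2 x E k = 2 + E (k - 1) + E (k + 1)],  [E 0 = E (d + 1) = 0],
    already satisfied, with an index shift, by the partial sums. For [x >= 1]
    the function [k (d + 1 - k)], whose second difference is [-2], is a
    supersolution, so it bounds the partial sums ([walk_series_le]); this gives
    convergence for all [x >= 1], including the endpoint [x = 1], where
    bounding the number of walks by [2 ^ n] would not suffice.

    Starting from [E 0 = 0], the recurrence determines all [E k] from [E 1], and
    its inhomogeneous term disappears on taking differences:
      [E (k + 2) - E (k + 1) = E 1 * V_(k + 1) (x) - 2 U_k (x)],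
      [E (k + 2) - E k       = 2 (E 1 * T_(k + 1) (x) - W_k (x))]
    ([potential_step], [potential_double_step]). The reflection [k -> d + 1 - k]
    preserves the walks, hence [E]. One of these differences, taken across the
    centre, therefore vanishes: the one-step difference when [d] is even and the
    two-step difference when [d] is odd. Solving for [E 1] yields the two cases
    of [g] ([potential_at1_g]); the denominators are positive because a
    Chebyshev family starting with [0 < P0 <= P1] is nondecreasing in the
    index at [x >= 1]. *)

(** * Symmetric paths and their first halves *)

Definition rise (w : seq bool) : int := \sum_(s <- w) (if s then 1 else -1).

Lemma heightE (w : seq bool) (k : nat) : height w k = rise (take k w).
Proof. by []. Qed.

Lemma rise_cat (u v : seq bool) : rise (u ++ v) = rise u + rise v.
Proof. by rewrite /rise big_cat. Qed.

Lemma rise_cons (s : bool) (u : seq bool) :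
  rise (s :: u) = (if s then 1 else -1) + rise u.
Proof. by rewrite /rise big_cons. Qed.

(** Reflection of a path in a vertical line reverses the order of the steps and
    exchanges rises and falls. *)
Definition mirror (w : seq bool) : seq bool := rev (map negb w).

Lemma size_mirror (w : seq bool) : size (mirror w) = size w.
Proof. by rewrite size_rev size_map. Qed.

Lemma mirrorK : involutive mirror.
Proof. by move=> w; rewrite /mirror map_rev revK (mapK negbK). Qed.

Lemma mirror_cat (u v : seq bool) : mirror (u ++ v) = mirror v ++ mirror u.
Proof. by rewrite /mirror map_cat rev_cat. Qed.

Lemma rise_mirror (w : seq bool) : rise (mirror w) = - rise w.
Proof.
elim: w => [|s w IHw]; first by rewrite /rise big_nil oppr0.
rewrite -cat1s mirror_cat !rise_cat IHw opprD addrC; congr (_ + _).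
by rewrite /rise /mirror /= !big_cons !big_nil; case: s.
Qed.

(** A self-mirrored path has total rise equal to its own opposite, hence 0, and
    its last [k] steps mirror its first [k]. *)
Lemma height_mirror (w : seq bool) (k : nat) :
  w = mirror w -> (k <= size w)%N -> height w (size w - k) = height w k.
Proof.
move=> wE lek; have rw0 : rise w = 0.
  by move: (rise_mirror w); rewrite -wE => ?; lia.
have dropE : drop (size w - k) w = mirror (take k w).
  rewrite {2}wE -[in mirror w](cat_take_drop k w) mirror_cat drop_size_cat //.
  by rewrite size_mirror size_drop.
have := rise_cat (take (size w - k) w) (drop (size w - k) w).
rewrite cat_take_drop rw0 dropE rise_mirror !heightE; lia.
Qed.

Lemma heightS (w : seq bool) (k : nat) : (k < size w)%N ->
  height w k.+1 = height w k + (if nth false w k then 1 else -1).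
Proof.
move=> ltk; rewrite !heightE (take_nth false) // -cats1 rise_cat.
by rewrite rise_cons /rise big_nil addr0.
Qed.

(** Symmetry of the heights passes to their increments, the steps. *)
Lemma symmetric_pathP (n : nat) (w : (2 * n).-tuple bool) :
  reflect (w = mirror w :> seq bool) (symmetric_path w).
Proof.
have szw := size_tuple w.
apply: (iffP forallP) => [sym_w|wE k]; last first.
  have := height_mirror (k := k) wE; rewrite szw -ltnS ltn_ord.
  by move=> /(_ isT) ->.
apply: (@eq_from_nth _ false) => [|i]; first by rewrite size_mirror.
rewrite szw => lti; rewrite /mirror nth_rev ?size_map szw //.
rewrite (nth_map false) ?szw; last by lia.
have hsym k : (k <= 2 * n)%N -> height w (2 * n - k) = height w k.
  by move=> lek; have /eqP := sym_w (inord k); rewrite inordK.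
have := heightS (w := w) (k := i); rewrite szw => /(_ lti).
have := heightS (w := w) (k := 2 * n - i.+1); rewrite szw.
have -> : (2 * n - i.+1).+1 = (2 * n - i)%N by lia.
rewrite (hsym i (ltnW lti)) (hsym i.+1 lti) => /(_ ltac:(lia)).
by case: (nth _ _ _); case: (nth _ _ _) => /=; lia.
Qed.

(** The constant word is only a default value, never reached since the length is
    right; it avoids carrying a size proof in the term. *)
Definition double_tuple (n : nat) (u : n.-tuple bool) : (2 * n).-tuple bool :=
  insubd [tuple of nseq (2 * n) false] (u ++ mirror u).

Lemma val_double_tuple (n : nat) (u : n.-tuple bool) :
  double_tuple u = u ++ mirror u :> seq bool.
Proof.
by rewrite val_insubd size_cat size_mirror size_tuple addnn mul2n eqxx.
Qed.

Lemma double_tuple_inj (n : nat) : injective (@double_tuple n).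
Proof.
move=> u v /(congr1 (@tval _ _)); rewrite !val_double_tuple => /eqP.
by rewrite eqseq_cat ?size_tuple // => /andP[/eqP/val_inj].
Qed.

(** Height [h] corresponds to vertex [h + 1], so that the lower wall is 0 and
    stays in [nat]. *)
Fixpoint confined (d k : nat) (u : seq bool) : bool :=
  (0 < k <= d)%N &&
  (if u is s :: u' then confined d (if s then k.+1 else k.-1) u' else true).

Lemma confinedP (d k : nat) (u : seq bool) :
  reflect (forall i, (i <= size u)%N -> 1 <= k%:Z + height u i <= d%:Z)
          (confined d k u).
Proof.
elim: u k => [|s u IHu] k.
  rewrite /= andbT; apply: (iffP idP) => [kd i _|/(_ 0%N isT)].
    by rewrite heightE /rise big_nil; lia.
  by rewrite heightE /rise big_nil; lia.
apply: (iffP andP) => [[kd /IHu cu] [|i] lei|H].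
- by rewrite heightE /rise big_nil; lia.
- by have := cu i lei; rewrite !heightE /= rise_cons; case: ifP; lia.
have kd : (0 < k <= d)%N.
  by have := H 0%N isT; rewrite heightE /rise big_nil; lia.
split=> //; apply/IHu => i lei; have := H i.+1 lei.
by rewrite !heightE /= rise_cons; case: ifP; lia.
Qed.

(** Doubling a walk is injective, and its image is the set of symmetric Dyck
    paths: the height bounds on the second half follow from those on the first,
    and so does the return to height 0. *)
Lemma DeltaS_confined (n h : nat) :
  DeltaS n h = #|[pred u : n.-tuple bool | confined h.+1 1 u]|.
Proof.
rewrite /DeltaS -(card_imset _ (@double_tuple_inj n)); apply: eq_card => w.
have lt2 k : (k <= n)%N -> (k < (2 * n).+1)%N by lia.
rewrite inE; apply/andP/imsetP => [[/andP[_ /forallP dw] sw]|[u]].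
  have szt : size (take n w) == n by rewrite size_takel // size_tuple; lia.
  exists (Tuple szt); last first.
    apply: val_inj; rewrite [RHS]val_double_tuple /=.
    rewrite -[LHS](cat_take_drop n); congr (_ ++ _).
    rewrite {1}(symmetric_pathP _ sw) -[in mirror w](cat_take_drop n w).
    rewrite mirror_cat drop_size_cat // size_mirror size_drop size_tuple.
    by lia.
  rewrite inE; apply/confinedP => i /=; rewrite (eqP szt) => lei.
  have := dw (Ordinal (lt2 i lei)); rewrite !heightE /= take_takel //.
  lia.
rewrite inE => /confinedP; rewrite size_tuple => cu ->.
have sw : symmetric_path (double_tuple u).
  by apply/symmetric_pathP; rewrite val_double_tuple mirror_cat mirrorK.
have bd i : (i <= n)%N -> 0 <= height (double_tuple u) i <= h%:Z.
  move=> lei; have := cu i lei; rewrite !heightE val_double_tuple.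
  by rewrite takel_cat ?size_tuple //; lia.
have symw k : (k <= 2 * n)%N ->
    height (double_tuple u) (2 * n - k) = height (double_tuple u) k.
  move=> lek; have /forallP/(_ (inord k))/eqP := sw.
  by rewrite inordK.
split=> //; apply/andP; split.
  have := symw 0%N isT; rewrite subn0 => ->.
  by rewrite heightE take0 /rise big_nil.
apply/forallP => k; have [lek|ltk] := leqP k n; first exact: bd.
by have := ltn_ord k; rewrite ltnS => lek; rewrite -symw //; apply: bd; lia.
Qed.

(** * Counting walks by their first step *)

Fixpoint walks (d n k : nat) : nat :=
  if (0 < k <= d)%N then
    if n is n'.+1 then (walks d n' k.-1 + walks d n' k.+1)%N else 1%N
  else 0%N.

Lemma card_confined (d n k : nat) :
  #|[pred u : n.-tuple bool | confined d k u]| = walks d n k.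
Proof.
elim: n k => [|n IHn] k; rewrite [walks _ _ _]/=; case: ifPn => kd.
- rewrite (eq_card (B := predT)) ?card_tuple ?expn0 // => u.
  by rewrite [u]tuple0 !inE /= kd.
- by rewrite eq_card0 // => u; rewrite [u]tuple0 !inE /= (negbTE kd).
- rewrite -!IHn -!sum1_card.
  rewrite (reindex (fun p : bool * n.-tuple bool => cons_tuple p.1 p.2)) /=.
    transitivity (\sum_(s : bool) \sum_(u : n.-tuple bool |
        confined d (if s then k.+1 else k.-1) u) 1)%N.
      by rewrite pair_big_dep; apply: eq_bigl => -[s u]; rewrite inE /= kd.
    by rewrite big_bool addnC.
  exists (fun u : n.+1.-tuple bool => (thead u, [tuple of behead u])).
    by move=> [s u] _; congr (_, _); apply: val_inj.
  by move=> u _; rewrite [RHS]tuple_eta; apply: val_inj.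
- rewrite eq_card0 // => u; case/tupleP: u => s u.
  by rewrite !inE /= (negbTE kd).
Qed.

Lemma walks_outside (d n k : nat) : ~~ (0 < k <= d)%N -> walks d n k = 0%N.
Proof. by case: n => [|n] /= /negbTE ->. Qed.

Lemma walks_reflect (d n k : nat) : (k <= d.+1)%N ->
  walks d n (d.+1 - k) = walks d n k.
Proof.
elim: n k => [|n IHn] k lek /=;
  have -> : (0 < d.+1 - k <= d)%N = (0 < k <= d)%N by lia.
  by [].
case: ifP => // kd; rewrite addnC; congr addn.
  by rewrite -(IHn k.-1); [congr walks|]; lia.
by rewrite -(IHn k.+1); [congr walks|]; lia.
Qed.

(** * Convergence of the walk series *)

Definition walk_series (R : realType) (x : R) (d k : nat) : R^nat :=
  series (fun i => (walks d i k)%:R / (2 ^+ i * x ^+ i.+1)).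

(** The term of index 0 contributes the constant 2; the first-step recurrence
    accounts for the others. *)
Lemma walk_seriesS (R : realType) (x : R) (d k N : nat) :
  x != 0 -> (0 < k <= d)%N ->
  2 * x * walk_series x d k N.+1 =
  2 + walk_series x d k.-1 N + walk_series x d k.+1 N.
Proof.
move=> x0 kd; rewrite /walk_series /series /= big_nat_recl //= kd.
rewrite -addrA -big_split /= mulrDr; congr (_ + _).
  by rewrite expr0 expr1; field.
rewrite mulr_sumr; apply: eq_bigr => i _.
rewrite natrD [2 ^+ i.+1]exprS [x ^+ i.+2]exprS.
by field; rewrite ?expf_neq0.
Qed.

Lemma walk_series_outside (R : realType) (x : R) (d k N : nat) :
  ~~ (0 < k <= d)%N -> walk_series x d k N = 0.
Proof.
move=> kd; rewrite /walk_series /series /= big1 // => i _.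
by rewrite walks_outside // mul0r.
Qed.

(** The bound solves the recurrence at [x = 1] and is a supersolution for larger
    [x]; since each partial sum is computed from the preceding ones with
    nonnegative coefficients, a supersolution dominates all of them. *)
Lemma walk_series_le (R : realType) (x : R) (d k N : nat) :
  1 <= x -> (k <= d.+1)%N -> walk_series x d k N <= (k * (d.+1 - k))%:R.
Proof.
move=> x1; elim: N k => [|N IHN] k lek.
  by rewrite /walk_series /series /= big_geq.
have [kd|kd] := boolP (0 < k <= d)%N; last by rewrite walk_series_outside.
have x0 : 0 < x by lra.
have b1 := IHN k.-1 ltac:(lia); have b2 := IHN k.+1 ltac:(lia).
have := walk_seriesS N (lt0r_neq0 x0) kd; rewrite mulrAC mulrC => eqS.
(* The parabola has second difference -2, which absorbs the constant term. *)
have balance : (k.-1 * (d.+1 - k.-1))%:R + (k.+1 * (d.+1 - k.+1))%:R + 2 =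
    2 * (k * (d.+1 - k))%:R :> R.
  by rewrite -!natrD -natrM; congr (_%:R); nia.
rewrite -(ler_pM2l (ltr0n _ 2 : 0 < 2 :> R)) -balance.
rewrite -(ler_pM2l x0) eqS.
apply: (@le_trans _ _ ((k.-1 * (d.+1 - k.-1))%:R
                       + (k.+1 * (d.+1 - k.+1))%:R + 2%:R)).
  by rewrite -addrA addrC lerD // lerD.
by rewrite ler_peMl // !addr_ge0.
Qed.

Lemma walk_series_cvg (R : realType) (x : R) (d k : nat) :
  1 <= x -> (k <= d.+1)%N -> cvgn (walk_series x d k).
Proof.
move=> x1 lek; apply: nondecreasing_is_cvgn.
  apply: nondecreasing_series => i _ _.
  by rewrite divr_ge0 // mulr_ge0 // exprn_ge0 //; lra.
by exists (k * (d.+1 - k))%:R => _ [N _ <-]; exact: walk_series_le.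
Qed.

Lemma walk_series_lim (R : realType) (x : R) (d k : nat) :
    1 <= x -> (k < d)%N ->
  2 * x * limn (walk_series x d k.+1) =
  2 + limn (walk_series x d k) + limn (walk_series x d k.+2).
Proof.
move=> x1 ltk; have x0 : x != 0 by apply: lt0r_neq0; lra.
have cvgL : (fun N => 2 * x * walk_series x d k.+1 N.+1) @ \oo
    --> 2 * x * limn (walk_series x d k.+1).
  apply: cvgMl_tmp; rewrite (cvg_shiftS (walk_series x d k.+1)).
  by apply: walk_series_cvg => //; lia.
have cvgR : (fun N => 2 + walk_series x d k N + walk_series x d k.+2 N) @ \oo
    --> 2 + limn (walk_series x d k) + limn (walk_series x d k.+2).
  by apply: cvgD; [apply: cvgD; [exact: cvg_cst|]|];
    apply: walk_series_cvg => //; lia.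
have recE : (fun N => 2 * x * walk_series x d k.+1 N.+1) =
    (fun N => 2 + walk_series x d k N + walk_series x d k.+2 N).
  by apply/funext => N; rewrite walk_seriesS.
by move: cvgL; rewrite recE => cvgL; apply: cvg_unique cvgL cvgR.
Qed.

(** * Chebyshev families and the boundary value problem *)

Lemma chebyshevSS (R : comNzRingType) (P0 P1 : {poly R}) (k : nat) (x : R) :
  (Defs.chebyshev P0 P1 k.+2).[x] =
  2 * x * (Defs.chebyshev P0 P1 k.+1).[x] - (Defs.chebyshev P0 P1 k).[x].
Proof.
by rewrite /= hornerD hornerN !hornerM hornerX -[2%:R]polyC_natr hornerC.
Qed.

(** From [P_k <= P_(k + 1)] the recurrence gives
    [P_(k + 2) - P_(k + 1) >= P_(k + 1) - P_k >= 0] when [x >= 1]. *)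
Lemma chebyshev_gt0 (R : realDomainType) (P0 P1 : {poly R}) (k : nat) (x : R) :
  1 <= x -> 0 < P0.[x] -> P0.[x] <= P1.[x] ->
  0 < (Defs.chebyshev P0 P1 k).[x].
Proof.
move=> x1 P0_gt0 P01.
suff : 0 < (Defs.chebyshev P0 P1 k).[x] <= (Defs.chebyshev P0 P1 k.+1).[x].
  by case/andP.
elim: k => [|k /andP[pk lek]]; first by rewrite P0_gt0.
by rewrite chebyshevSS; apply/andP; split; nra.
Qed.

(** The recurrence for [s] is required only below [n], since that of [E] below
    holds only between the walls. *)
Lemma second_order_unique (R : nzRingType) (c : R) (n : nat) (s t : nat -> R) :
    ((0 < n)%N -> s 0%N = t 0%N) -> ((1 < n)%N -> s 1%N = t 1%N) ->
    (forall k, (k.+2 < n)%N -> s k.+2 = c * s k.+1 - s k) ->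
    (forall k, t k.+2 = c * t k.+1 - t k) ->
  forall k, (k < n)%N -> s k = t k.
Proof.
move=> st0 st1 sS tS; elim/ltn_ind => -[|[|k]] IHk ltk.
- exact: st0.
- exact: st1.
by rewrite sS // tS !IHk //; lia.
Qed.

(** The differences satisfy the homogeneous Chebyshev recurrence, because the
    constant 2 cancels; the combination of [V] and [U] on the right is the
    solution with the same first two values. *)
Lemma potential_step (R : comNzRingType) (x : R) (d : nat) (E : nat -> R) :
    E 0%N = 0 ->
    (forall k, (k < d)%N -> 2 * x * E k.+1 = 2 + E k + E k.+2) ->
  forall k, (k < d)%N -> E k.+2 - E k.+1 =
    E 1%N * (chebV R k.+1).[x] - 2 * (chebU R k).[x].
Proof.
move=> E0 EE.
have ES k : (k < d)%N -> E k.+2 = 2 * x * E k.+1 - 2 - E k.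
  by move=> /EE ->; ring.
apply: (second_order_unique (c := 2 * x)) => [d0|d1|k ltk|k].
- by rewrite ES // E0 /= !hornerE /=; ring.
- by rewrite ES // ES 1?ltnW // E0 [chebV R 2]/= !hornerE /=; ring.
- rewrite (ES k.+2) // (ES k.+1) 1?ltnW // (ES k); last by lia.
  by ring.
by rewrite /chebV /chebU !chebyshevSS; ring.
Qed.

(** Same argument for differences two apart, which straddle the central vertex
    of a path with an odd number of vertices. *)
Lemma potential_double_step (R : comNzRingType) (x : R) (d : nat)
    (E : nat -> R) :
    E 0%N = 0 ->
    (forall k, (k < d)%N -> 2 * x * E k.+1 = 2 + E k + E k.+2) ->
  forall k, (k < d)%N -> E k.+2 - E k =
    2 * (E 1%N * (chebT R k.+1).[x] - (chebW R k).[x]).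
Proof.
move=> E0 EE.
have ES k : (k < d)%N -> E k.+2 = 2 * x * E k.+1 - 2 - E k.
  by move=> /EE ->; ring.
apply: (second_order_unique (c := 2 * x)) => [d0|d1|k ltk|k].
- by rewrite ES // E0 /= !hornerE /=; ring.
- by rewrite ES // ES 1?ltnW // E0 [chebT R 2]/= !hornerE /=; ring.
- rewrite (ES k.+2) // (ES k.+1) 1?ltnW // (ES k); last by lia.
  by ring.
by rewrite /chebT /chebW !chebyshevSS; ring.
Qed.

(** The reflection symmetry replaces the boundary condition at [d + 1]: it makes
    the difference of [E] across the centre vanish, and that equation is linear
    in [E 1]. *)
Lemma potential_at1_g (R : realType) (x : R) (d : nat) (E : nat -> R) :
    (0 < d)%N -> 1 <= x -> E 0%N = 0 ->
    (forall k, (k < d)%N -> 2 * x * E k.+1 = 2 + E k + E k.+2) ->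
    (forall k, (k <= d.+1)%N -> E (d.+1 - k)%N = E k) ->
  E 1%N = g d x.
Proof.
move=> d_gt0 x1 E0 EE E_reflect; rewrite /g; case: ifPn => [d_odd|d_even].
  have [m dE] : exists m, d = m.*2.+1 by exists d./2; lia.
  have -> : d.-1./2 = m by lia.
  have -> : d.+1./2 = m.+1 by lia.
  have T_gt0 : 0 < (chebT R m.+1).[x].
    by apply: chebyshev_gt0 => //; rewrite !hornerE.
  have Em : E m.+2 = E m by rewrite -(E_reflect m); [congr E|]; lia.
  have := potential_double_step E0 EE (k := m) ltac:(lia).
  rewrite Em subrr => /esym/eqP; rewrite mulf_eq0 pnatr_eq0 /= subr_eq0.
  by move=> /eqP <-; rewrite mulfK // lt0r_neq0.
have [m dE] : exists m, d = m.+1.*2 by exists d./2.-1; lia.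
have -> : d./2 = m.+1 by lia.
have V_gt0 : 0 < (chebV R m.+1).[x].
  by apply: chebyshev_gt0 => //; rewrite !hornerE //=; lra.
have Em : E m.+2 = E m.+1 by rewrite -(E_reflect m.+1); [congr E|]; lia.
have := potential_step E0 EE (k := m) ltac:(lia).
rewrite Em subrr => /esym/eqP; rewrite subr_eq0 => /eqP <-.
by rewrite mulfK // lt0r_neq0.
Qed.

Theorem theorem16 (R : realType) (d : nat) (hd : (1 <= d)%N)
    (x : R) (hx : 1 <= x) :
  series (fun i : nat => (DeltaS i d.-1)%:R / (2 ^+ i * x ^+ i.+1)) @ \oo
    --> g d x.
Proof.
have Delta_walks : (fun i => (DeltaS i d.-1)%:R / (2 ^+ i * x ^+ i.+1)) =
    (fun i => (walks d i 1)%:R / (2 ^+ i * x ^+ i.+1)).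
  by apply/funext => i; rewrite DeltaS_confined card_confined prednK.
rewrite Delta_walks -/(walk_series x d 1).
rewrite -(@potential_at1_g _ x d (fun k => limn (walk_series x d k))) //.
- exact: walk_series_cvg.
- rewrite (_ : walk_series x d 0 = cst 0) ?lim_cst //.
  by apply/funext => N; rewrite walk_series_outside.
- by move=> k ltk; exact: walk_series_lim.
- move=> k lek; congr (limn (series _)); apply/funext => i.
  by rewrite walks_reflect.
Qed.
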